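(* Let $\mathsf L\in\{\mathsf N_\preccurlyeq,\mathsf{NN}_\preccurlyeq,\mathsf{NT}_\preccurlyeq,\mathsf{NW}_\preccurlyeq,\mathsf{NC}_\preccurlyeq,\mathsf{NA}_\preccurlyeq,\mathsf{NNA}_\preccurlyeq\}$ and let $\mathsf{G.L}$ be the corresponding sequent calculus. If the sequent $\Gamma\Rightarrow\Delta$ is derivable in $\mathsf{G.L}$, then $\bigwedge\Gamma\to\bigvee\Delta$ is derivable in $\mathsf L$.
   Context: Language: formulas $A ::= p \mid \bot \mid A\to A \mid A \preccurlyeq A$ over countably many atoms; $\top,\neg,\wedge,\vee$ defined as usual. Hilbert systems: axioms/rules (cpr) from $A\to B$ infer $B\preccurlyeq A$; (tr) $(A\preccurlyeq B)\wedge(B\preccurlyeq C)\to(A\preccurlyeq C)$; (or) $(A\preccurlyeq B)\wedge(A\preccurlyeq C)\to(A\preccurlyeq B\vee C)$; (n) $\neg(\bot\preccurlyeq\top)$; (t) $(\bot\preccurlyeq A)\to\neg A$; (w) $A\to(A\preccurlyeq\top)$; (c) $(A\preccurlyeq\top)\to A$; (a$-$) $(A\preccurlyeq B)\to(\bot\preccurlyeq\neg(A\preccurlyeq B))$; (a) $\neg(A\preccurlyeq B)\to(\bot\preccurlyeq(A\preccurlyeq B))$. $\mathsf N_\preccurlyeq$ = classical propositional logic plus tr, or, cpr; $\mathsf{NN}_\preccurlyeq=\mathsf N_\preccurlyeq+$n; $\mathsf{NT}_\preccurlyeq=\mathsf N_\preccurlyeq+$t; $\mathsf{NW}_\preccurlyeq=\mathsf{NT}_\preccurlyeq+$w;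 $\mathsf{NC}_\preccurlyeq=\mathsf{NW}_\preccurlyeq+$c; $\mathsf{NA}_\preccurlyeq=\mathsf N_\preccurlyeq+$a$-$,a; $\mathsf{NNA}_\preccurlyeq=\mathsf{NN}_\preccurlyeq+$a$-$,a. Derivability: finite sequence of axioms, modus ponens and cpr applications. Sequents $\Gamma\Rightarrow\Delta$: $\Gamma,\Delta$ finite multisets of formulas, read as $\bigwedge\Gamma\to\bigvee\Delta$. Rules (write $\Sigma^{\preccurlyeq}$ for $C_1\preccurlyeq D_1,\dots,C_n\preccurlyeq D_n$; $\Gamma^{\preccurlyeq}$, $\Delta^{\preccurlyeq}$ for the $\preccurlyeq$-formulas in $\Gamma$, $\Delta$): init: $\Gamma,p\Rightarrow p,\Delta$; $\bot_L$: $\Gamma,\bot\Rightarrow\Delta$; $\to_L$: from $\Gamma\Rightarrow A,\Delta$ and $\Gamma,B\Rightarrow\Delta$ infer $\Gamma,A\to B\Rightarrow\Delta$; $\to_R$: from $\Gamma,A\Rightarrow B,\Delta$ infer $\Gamma\Rightarrow A\to B,\Delta$. $\mathrm{CP}_n$: from $\{C_k\Rightarrow A,D_1,\dots,D_{k-1}\}_{1\le k\le n}$ and $B\Rightarrow A,D_1,\dots,D_n$ infer $\Gamma,\Sigma^{\preccurlyeq}\Rightarrow A\preccurlyeq B,\Delta$. $\mathrm N_n$: from $\{C_k\Rightarrow D_1,\dots,D_{k-1}\}_{k\le n}$ and $\Rightarrow D_1,\dots,D_n$ infer $\Gamma,\Sigma^{\preccurlyeq}\Rightarrow\Delta$. $\mathrm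 T_n$: from $\{C_k\Rightarrow D_1,\dots,D_{k-1}\}_{k\le n}$ and $\Gamma,\Sigma^{\preccurlyeq}\Rightarrow D_1,\dots,D_n,\Delta$ infer $\Gamma,\Sigma^{\preccurlyeq}\Rightarrow\Delta$. $\mathrm W_n$: from $\{C_k\Rightarrow A,D_1,\dots,D_{k-1}\}_{k\le n}$ and $\Gamma,\Sigma^{\preccurlyeq}\Rightarrow A,A\preccurlyeq B,D_1,\dots,D_n,\Delta$ infer $\Gamma,\Sigma^{\preccurlyeq}\Rightarrow A\preccurlyeq B,\Delta$. $\mathrm W_0$: from $\Gamma\Rightarrow A\preccurlyeq B,A,\Delta$ infer $\Gamma\Rightarrow A\preccurlyeq B,\Delta$. $\mathrm C_0$: from $\Gamma,A\preccurlyeq B,A\Rightarrow\Delta$ and $\Gamma,A\preccurlyeq B\Rightarrow B,\Delta$ infer $\Gamma,A\preccurlyeq B\Rightarrow\Delta$. $\mathrm A_n$: from $\{\Gamma^{\preccurlyeq},\Sigma^{\preccurlyeq},C_k\Rightarrow A\preccurlyeq B,A,D_1,\dots,D_{k-1},\Delta^{\preccurlyeq}\}_{k\le n}$ and $\Gamma^{\preccurlyeq},\Sigma^{\preccurlyeq},B\Rightarrow A\preccurlyeq B,A,D_1,\dots,D_n,\Delta^{\preccurlyeq}$ infer $\Gamma,\Sigma^{\preccurlyeq}\Rightarrow A\preccurlyeq B,\Delta$. $\mathrm N^A_n$: from $\{\Gamma^{\preccurlyeq},\Sigma^{\preccurlyeq},C_k\Rightarrow D_1,\dots,D_{k-1},\Delta^{\preccurlyeq}\}_{k\le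 n}$ and $\Gamma^{\preccurlyeq},\Sigma^{\preccurlyeq}\Rightarrow D_1,\dots,D_n,\Delta^{\preccurlyeq}$ infer $\Gamma,\Sigma^{\preccurlyeq}\Rightarrow\Delta$. Calculi: $\mathsf{G.N}=\{\mathrm{init},\bot_L,\to_L,\to_R\}\cup\{\mathrm{CP}_n\mid n\ge0\}$; $\mathsf{G.NN}=\mathsf{G.N}\cup\{\mathrm N_n\mid n\ge1\}$; $\mathsf{G.NT}=\mathsf{G.N}\cup\{\mathrm T_n\mid n\ge1\}$; $\mathsf{G.NW}=\mathsf{G.N}\cup\{\mathrm W_n\mid n\ge0\}\cup\{\mathrm T_n\mid n\ge1\}$; $\mathsf{G.NC}=\mathsf{G.N}\cup\{\mathrm W_0,\mathrm C_0\}$; $\mathsf{G.NA}=\{\mathrm{init},\bot_L,\to_L,\to_R\}\cup\{\mathrm A_n\mid n\ge0\}$; $\mathsf{G.NNA}=\mathsf{G.NA}\cup\{\mathrm N^A_n\mid n\ge1\}$. The calculus corresponding to $\mathsf N X_\preccurlyeq$ is $\mathsf{G.N}X$. *)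

(* Defs.v *)
From HB Require Import structures.
From mathcomp Require Import all_boot.
From mathcomp Require Import finmap multiset.

Set Implicit Arguments.
Unset Strict Implicit.
Unset Printing Implicit Defensive.

Local Open Scope mset_scope.

(** * Language *)

Inductive form : Type :=
| Atom of nat
| Bot
| Imp of form & form
| Cp of form & form.

(* Multisets need a choiceType: [form] is encoded in the generic tree type. *)
Fixpoint tree_of_form (A : form) : GenTree.tree nat :=
  match A with
  | Atom p => GenTree.Leaf p
  | Bot => GenTree.Node 0 [::]
  | Imp A B => GenTree.Node 1 [:: tree_of_form A; tree_of_form B]
  | Cp A B => GenTree.Node 2 [:: tree_of_form A; tree_of_form B]
  end.

Fixpoint form_of_tree (t : GenTree.tree nat) : form :=
  match t with
  | GenTree.Leaf p => Atom p
  | GenTree.Node 1 [:: t1; t2] => Imp (form_of_tree t1) (form_of_tree t2)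
  | GenTree.Node 2 [:: t1; t2] => Cp (form_of_tree t1) (form_of_tree t2)
  | _ => Bot
  end.

Lemma tree_of_formK : cancel tree_of_form form_of_tree.
Proof. by elim=> //= A -> B ->. Qed.

HB.instance Definition _ := Countable.copy form (can_type tree_of_formK).

Definition Neg (A : form) : form := Imp A Bot.
Definition Top : form := Neg Bot.
Definition And (A B : form) : form := Neg (Imp A (Neg B)).
Definition Or (A B : form) : form := Imp (Neg A) B.

Declare Scope fml_scope.
Delimit Scope fml_scope with fml.
Bind Scope fml_scope with form.
Notation "⊥" := Bot (at level 0) : fml_scope.
Notation "⊤" := Top (at level 0) : fml_scope.
Notation "¬ A" := (Neg A) (at level 35, right associativity) : fml_scope.
Notation "A ≼ B" := (Cp A B) (at level 38, no associativity) : fml_scope.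
Notation "A ∧ B" := (And A B) (at level 40, left associativity) : fml_scope.
Notation "A ∨ B" := (Or A B) (at level 42, left associativity) : fml_scope.
Notation "A ⟶ B" := (Imp A B) (at level 55, right associativity) : fml_scope.
Local Open Scope fml_scope.

(* The members are taken in the order of the library's enumeration of the
   multiset; the empty conjunction is ⊤ and the empty disjunction is ⊥. *)
Definition bigAnd (Γ : {mset form}) : form := foldr And ⊤ Γ.
Definition bigOr (Δ : {mset form}) : form := foldr Or ⊥ Δ.

(** * Hilbert systems *)

Inductive logic := L_N | L_NN | L_NT | L_NW | L_NC | L_NA | L_NNA.

Inductive ax_n : form -> Prop :=
| Ax_n : ax_n (¬ (⊥ ≼ ⊤)).
Inductive ax_t : form -> Prop :=
| Ax_t A : ax_t ((⊥ ≼ A) ⟶ ¬ A).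
Inductive ax_w : form -> Prop :=
| Ax_w A : ax_w (A ⟶ (A ≼ ⊤)).
Inductive ax_c : form -> Prop :=
| Ax_c A : ax_c ((A ≼ ⊤) ⟶ A).
Inductive ax_am : form -> Prop :=
| Ax_am A B : ax_am ((A ≼ B) ⟶ (⊥ ≼ ¬ (A ≼ B))).
Inductive ax_a : form -> Prop :=
| Ax_a A B : ax_a (¬ (A ≼ B) ⟶ (⊥ ≼ (A ≼ B))).

Definition extra_axiom (L : logic) (A : form) : Prop :=
  match L with
  | L_N => False
  | L_NN => ax_n A
  | L_NT => ax_t A
  | L_NW => ax_t A \/ ax_w A
  | L_NC => ax_t A \/ ax_w A \/ ax_c A
  | L_NA => ax_am A \/ ax_a A
  | L_NNA => ax_n A \/ ax_am A \/ ax_a A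
  end.

(* K, S and double negation elimination with modus ponens axiomatize classical
   propositional logic over → and ⊥. *)
Inductive hilbert (L : logic) : form -> Prop :=
| H_K A B : hilbert L (A ⟶ B ⟶ A)
| H_S A B C : hilbert L ((A ⟶ B ⟶ C) ⟶ (A ⟶ B) ⟶ A ⟶ C)
| H_DNE A : hilbert L (¬ ¬ A ⟶ A)
| H_tr A B C : hilbert L ((A ≼ B) ∧ (B ≼ C) ⟶ (A ≼ C))
| H_or A B C : hilbert L ((A ≼ B) ∧ (A ≼ C) ⟶ (A ≼ (B ∨ C)))
| H_extra A : extra_axiom L A -> hilbert L A
| H_mp A B : hilbert L (A ⟶ B) -> hilbert L A -> hilbert L B
| H_cpr A B : hilbert L (A ⟶ B) -> hilbert L (B ≼ A).

(** * Sequent calculi *)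

Definition sequent : Type := ({mset form} * {mset form})%type.
Notation "Γ ⇒ Δ" := ((Γ%mset, Δ%mset) : sequent)
  (at level 95, no associativity) : fml_scope.

(* [R ps s]: from the premises [ps] infer the conclusion [s]. *)
Definition rule : Type := seq sequent -> sequent -> Prop.

Definition is_cp (A : form) : bool := if A is Cp _ _ then true else false.
Definition cp_part (Γ : {mset form}) : {mset form} :=
  seq_mset [seq A <- Γ | is_cp A].

(* S lists the pairs (C_1, D_1), ..., (C_n, D_n); indices k : 'I_n start at 0,
   so [Cs S k] is C_(k+1), and [Ds S k] is the multiset D_1, ..., D_k. *)
Definition Sigma n (S : n.-tuple (form * form)) : {mset form} :=
  seq_mset [seq CD.1 ≼ CD.2 | CD <- S].
Definition Cs n (S : n.-tuple (form * form)) (k : 'I_n) : form := (tnth S k).1.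
Definition Ds n (S : n.-tuple (form * form)) (k : nat) : {mset form} :=
  seq_mset (take k [seq CD.2 | CD <- S]).

Inductive init : rule :=
| Init p Γ Δ : init [::] (Atom p +` Γ ⇒ Atom p +` Δ).

Inductive botL : rule :=
| BotL Γ Δ : botL [::] (⊥ +` Γ ⇒ Δ).

Inductive impL : rule :=
| ImpL A B Γ Δ :
    impL [:: (Γ ⇒ A +` Δ); (B +` Γ ⇒ Δ)] ((A ⟶ B) +` Γ ⇒ Δ).

Inductive impR : rule :=
| ImpR A B Γ Δ : impR [:: (A +` Γ ⇒ B +` Δ)] (Γ ⇒ (A ⟶ B) +` Δ).

Inductive ruleCP (n : nat) : rule :=
| RuleCP (S : n.-tuple (form * form)) A B Γ Δ :
    ruleCP n
      (rcons [seq ([mset Cs S k] ⇒ A +` Ds S k) | k <- enum 'I_n]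
             ([mset B] ⇒ A +` Ds S n))
      (Γ `+` Sigma S ⇒ (A ≼ B) +` Δ).

Inductive ruleN (n : nat) : rule :=
| RuleN (S : n.-tuple (form * form)) Γ Δ :
    ruleN n
      (rcons [seq ([mset Cs S k] ⇒ Ds S k) | k <- enum 'I_n]
             (mset0 ⇒ Ds S n))
      (Γ `+` Sigma S ⇒ Δ).

Inductive ruleT (n : nat) : rule :=
| RuleT (S : n.-tuple (form * form)) Γ Δ :
    ruleT n
      (rcons [seq ([mset Cs S k] ⇒ Ds S k) | k <- enum 'I_n]
             (Γ `+` Sigma S ⇒ Ds S n `+` Δ))
      (Γ `+` Sigma S ⇒ Δ).

Inductive ruleW (n : nat) : rule :=
| RuleW (S : n.-tuple (form * form)) A B Γ Δ :
    ruleW n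
      (rcons [seq ([mset Cs S k] ⇒ A +` Ds S k) | k <- enum 'I_n]
             (Γ `+` Sigma S ⇒ A +` ((A ≼ B) +` (Ds S n `+` Δ))))
      (Γ `+` Sigma S ⇒ (A ≼ B) +` Δ).

Inductive ruleC0 : rule :=
| RuleC0 A B Γ Δ :
    ruleC0 [:: (A +` ((A ≼ B) +` Γ) ⇒ Δ); ((A ≼ B) +` Γ ⇒ B +` Δ)]
           ((A ≼ B) +` Γ ⇒ Δ).

Inductive ruleA (n : nat) : rule :=
| RuleA (S : n.-tuple (form * form)) A B Γ Δ :
    ruleA n
      (rcons
         [seq (Cs S k +` (cp_part Γ `+` Sigma S)
               ⇒ (A ≼ B) +` (A +` (Ds S k `+` cp_part Δ))) | k <- enum 'I_n]
         (B +` (cp_part Γ `+` Sigma S)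
          ⇒ (A ≼ B) +` (A +` (Ds S n `+` cp_part Δ))))
      (Γ `+` Sigma S ⇒ (A ≼ B) +` Δ).

Inductive ruleNA (n : nat) : rule :=
| RuleNA (S : n.-tuple (form * form)) Γ Δ :
    ruleNA n
      (rcons
         [seq (Cs S k +` (cp_part Γ `+` Sigma S)
               ⇒ Ds S k `+` cp_part Δ) | k <- enum 'I_n]
         (cp_part Γ `+` Sigma S ⇒ Ds S n `+` cp_part Δ))
      (Γ `+` Sigma S ⇒ Δ).

Definition propositional : rule := fun ps s =>
  init ps s \/ botL ps s \/ impL ps s \/ impR ps s.
Definition GN : rule := fun ps s =>
  propositional ps s \/ exists n, ruleCP n ps s.
Definition GNN : rule := fun ps s =>
  GN ps s \/ exists2 n, 1 <= n & ruleN n ps s.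
Definition GNT : rule := fun ps s =>
  GN ps s \/ exists2 n, 1 <= n & ruleT n ps s.
Definition GNW : rule := fun ps s =>
  GN ps s \/ (exists n, ruleW n ps s) \/ exists2 n, 1 <= n & ruleT n ps s.
Definition GNC : rule := fun ps s =>
  GN ps s \/ ruleW 0 ps s \/ ruleC0 ps s.
Definition GNA : rule := fun ps s =>
  propositional ps s \/ exists n, ruleA n ps s.
Definition GNNA : rule := fun ps s =>
  GNA ps s \/ exists2 n, 1 <= n & ruleNA n ps s.

Definition calculus (L : logic) : rule :=
  match L with
  | L_N => GN
  | L_NN => GNN
  | L_NT => GNT
  | L_NW => GNW
  | L_NC => GNC
  | L_NA => GNA
  | L_NNA => GNNA
  end.

Inductive derivable (R : rule) : sequent -> Prop :=
| Derivable (ps : seq sequent) (s : sequent) :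
    R ps s -> (forall p, p \in ps -> derivable R p) -> derivable R s.

(* Main.v *)
(** Soundness is checked semantically.  An [L]-valuation is a Boolean valuation
    of all formulas (treating [A ≼ B] as an atom) that makes every theorem of
    [L] true; by Lindenbaum's lemma a formula true under all [L]-valuations is a
    theorem of [L].  For a fixed [L]-valuation [v] and a fixed [A], the set of
    [X] with [v (A ≼ X)] is, by (tr), (or) and (cpr), closed under disjunctions
    and under passing to formulas that [L]-imply a member.  Hence the premises
    of a [≼]-rule put [D_1, D_2, ...] one after the other in this set.  In the
    rules [A_n] and [N^A_n], (a) and (a-) also put there the negations of the
    context formulas true under [v] and the context formulas false under [v]. *)

Require Import Defs.
From mathcomp Require Import all_boot.
From mathcomp Require Import finmap multiset.
From mathcomp Require Import boolp.

Set Implicit Arguments.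
Unset Strict Implicit.
Unset Printing Implicit Defensive.

Local Open Scope mset_scope.
Local Open Scope fml_scope.

(** * Propositional derivations *)

Section Propositional.
Variable L : logic.
Implicit Types A B C M : form.
Local Notation "⊢ A" := (hilbert L A) (at level 90).

Lemma hilbert_const A B : ⊢ B -> ⊢ A ⟶ B.
Proof. exact/H_mp/H_K. Qed.

Lemma hilbert_app A B C : ⊢ A ⟶ B ⟶ C -> ⊢ A ⟶ B -> ⊢ A ⟶ C.
Proof. by move=> hABC; apply/H_mp/(H_mp (H_S _ _ _ _) hABC). Qed.

Lemma hilbert_id A : ⊢ A ⟶ A.
Proof. exact: hilbert_app (H_K _ _ _) (H_K _ _ A). Qed.

Lemma hilbert_trans A B C : ⊢ A ⟶ B -> ⊢ B ⟶ C -> ⊢ A ⟶ C.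
Proof. by move=> hAB hBC; apply: hilbert_app hAB; apply: hilbert_const. Qed.

Lemma hilbert_swap A B C : ⊢ A ⟶ B ⟶ C -> ⊢ B ⟶ A ⟶ C.
Proof.
by move=> hABC; apply: hilbert_trans (H_K _ _ _) (H_mp (H_S _ _ _ _) hABC).
Qed.

Lemma hilbert_contra A B : ⊢ A ⟶ B -> ⊢ ¬ B ⟶ ¬ A.
Proof.
move=> hAB; apply: hilbert_swap; apply: hilbert_trans hAB _.
by apply: hilbert_swap; apply: hilbert_id.
Qed.

(** Contraposing the first hypothesis and composing with the second gives ¬M → M, hence ¬¬M. *)
Lemma hilbert_cases A M : ⊢ A ⟶ M -> ⊢ ¬ A ⟶ M -> ⊢ M.
Proof.
move=> hA hNA; have hNM : ⊢ ¬ M ⟶ M := hilbert_trans (hilbert_contra hA) hNA.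
exact: H_mp (H_DNE _ _) (hilbert_app (hilbert_id (¬ M)) hNM).
Qed.

Lemma hilbert_efq A B : ⊢ ¬ A ⟶ A ⟶ B.
Proof.
have bot_B : ⊢ ⊥ ⟶ B := hilbert_trans (H_K _ _ (¬ B)) (H_DNE _ _).
exact: H_mp (H_S _ _ _ _) (hilbert_const A bot_B).
Qed.

Lemma hilbert_imp_lhs A B : ⊢ ¬ (A ⟶ B) ⟶ A.
Proof. exact: hilbert_trans (hilbert_contra (hilbert_efq A B)) (H_DNE _ _). Qed.

Lemma hilbert_imp_rhs A B : ⊢ ¬ (A ⟶ B) ⟶ ¬ B.
Proof. exact: hilbert_contra (H_K _ _ _). Qed.

Lemma hilbert_imp_elim A B M : ⊢ ¬ A ⟶ M -> ⊢ B ⟶ M -> ⊢ (A ⟶ B) ⟶ M.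
Proof.
move=> hNA hB; apply: (@hilbert_cases A).
- apply: hilbert_swap; apply: H_mp (H_S _ _ _ _) _.
  exact: hilbert_const.
- exact: hilbert_trans hNA (H_K _ _ _).
Qed.

End Propositional.

(** * Valuations *)

Record valuation (L : logic) (v : form -> bool) : Prop := Valuation {
  val_bot : v ⊥ = false;
  val_imp A B : v (A ⟶ B) = v A ==> v B;
  val_thm A : hilbert L A -> v A }.

(** * Lindenbaum's lemma *)

Section Lindenbaum.
Variables (L : logic) (A0 : form).
Hypothesis A0_unprovable : ~ hilbert L A0.
Local Notation "⊢ A" := (hilbert L A) (at level 90).

(* An increasing chain of unprovable formulas; the n-th step decides the
   formula [B] with code n: either [B] or [¬ B] implies [refuted n.+1]. *)
Fixpoint refuted (n : nat) : form :=
  if n isn't m.+1 then A0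
  else if (choice.unpickle m : option form) is Some B then
    if `[< hilbert L (B ⟶ refuted m) >] then refuted m else B ⟶ refuted m
  else refuted m.

Lemma refuted_unprovable n : ~ ⊢ refuted n.
Proof.
elim: n => //= n IHn; case: (choice.unpickle n) => // B.
by case: asboolP.
Qed.

Lemma refuted_le m n : m <= n -> ⊢ refuted m ⟶ refuted n.
Proof.
move=> /subnK <-; elim: (n - m) => [|d IHd]; first exact: hilbert_id.
apply: hilbert_trans IHd _; rewrite addSn /=.
case: (choice.unpickle (d + m)) => [B|]; last exact: hilbert_id.
by case: asboolP => _; [exact: hilbert_id | exact: H_K].
Qed.

Lemma imp_refuted_le B m n :
  m <= n -> ⊢ B ⟶ refuted m -> ⊢ B ⟶ refuted n.
Proof. by move=> le_mn hB; apply: hilbert_trans hB (refuted_le le_mn). Qed.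

(** The code of [B] is the stage that treats [B]. If [B] does not imply the current formula there,
    the next one is an implication with antecedent [B], which ¬B proves. *)
Lemma refuted_decides B :
  (exists n, ⊢ B ⟶ refuted n) \/ (exists n, ⊢ ¬ B ⟶ refuted n).
Proof.
have [hB|hNB] := pselect (⊢ B ⟶ refuted (choice.pickle B)).
  by left; exists (choice.pickle B).
right; exists (choice.pickle B).+1; rewrite /= choice.pickleK.
by case: asboolP => // _; apply: hilbert_efq.
Qed.

(** At the later of the two stages, a case split on [B] would prove an unprovable formula. *)
Lemma refuted_consistent B m n :
  ⊢ B ⟶ refuted m -> ⊢ ¬ B ⟶ refuted n -> False.
Proof.
move=> hB hNB; apply: (@refuted_unprovable (maxn m n)).
apply: (@hilbert_cases L B).
- exact: imp_refuted_le (leq_maxl _ _) hB.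
- exact: imp_refuted_le (leq_maxr _ _) hNB.
Qed.

(** Characteristic function of a maximal consistent set omitting [A0]. The chain [refuted] plays the
    role of falsum, so consistency is expressed with single formulas instead of sets. *)
Definition lindenbaum (B : form) : bool := `[< exists n, ⊢ ¬ B ⟶ refuted n >].

Lemma lindenbaumT B n : ⊢ ¬ B ⟶ refuted n -> lindenbaum B.
Proof. by move=> hNB; apply/asboolP; exists n. Qed.

Lemma lindenbaumF B n : ⊢ B ⟶ refuted n -> lindenbaum B = false.
Proof.
by move=> hB; apply/asboolP => -[m hNB]; apply: refuted_consistent hB hNB.
Qed.

Lemma lindenbaumP B :
  if lindenbaum B then exists n, ⊢ ¬ B ⟶ refuted n
  else exists n, ⊢ B ⟶ refuted n.
Proof.
rewrite /lindenbaum; case: asboolP => // nNB.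
by case: (refuted_decides B).
Qed.

Lemma lindenbaum_valuation : valuation L lindenbaum.
Proof.
split=> [|A B|A hA].
(* [refuted 0] is [A0], and ⊥ → [A0] passes through ¬¬[A0]. *)
- by apply: (@lindenbaumF _ 0); apply: hilbert_trans (H_K _ _ (¬ A0)) (H_DNE _ _).
- have := lindenbaumP A; case: (lindenbaum A) => -[n hA] /=; last first.
    by apply: (@lindenbaumT _ n); apply: hilbert_trans (hilbert_imp_lhs _ _ _) hA.
  have := lindenbaumP B; case: (lindenbaum B) => -[m hB].
    by apply: (@lindenbaumT _ m); apply: hilbert_trans (hilbert_imp_rhs _ _ _) hB.
  (* Here [A] is true and [B] false; at the common stage both ¬A and [B] imply the refuted formula,
     hence so does A → B. *)
  apply: (@lindenbaumF _ (maxn n m)); apply: hilbert_imp_elim.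
  + exact: imp_refuted_le (leq_maxl _ _) hA.
  + exact: imp_refuted_le (leq_maxr _ _) hB.
- apply: (@lindenbaumT _ 0); apply: H_mp (hilbert_swap (hilbert_efq _ _ _)) hA.
Qed.

Lemma lindenbaum_refutes : lindenbaum A0 = false.
Proof. exact: (@lindenbaumF _ 0 (hilbert_id _ _)). Qed.

End Lindenbaum.

Lemma hilbert_complete L A :
  (forall v, valuation L v -> v A) -> hilbert L A.
Proof.
move=> validA; apply: contrapT => nA.
by have := validA _ (lindenbaum_valuation nA); rewrite lindenbaum_refutes.
Qed.

Section Connectives.
Variables (L : logic) (v : form -> bool).
Hypothesis val_v : valuation L v.

Lemma val_neg A : v (¬ A) = ~~ v A.
Proof. by rewrite (val_imp val_v) (val_bot val_v) implybF. Qed.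

Lemma val_top : v ⊤.
Proof. by rewrite val_neg (val_bot val_v). Qed.

Lemma val_and A B : v (A ∧ B) = v A && v B.
Proof. by rewrite val_neg (val_imp val_v) val_neg implybN negb_imply andbC negbK. Qed.

Lemma val_or A B : v (A ∨ B) = v A || v B.
Proof. by rewrite (val_imp val_v) val_neg -implyNb. Qed.

Lemma val_big_and s : v (foldr And ⊤ s) = all v s.
Proof. by elim: s => [|A s IHs] /=; rewrite ?val_top // val_and IHs. Qed.

Lemma val_big_or s : v (foldr Or ⊥ s) = has v s.
Proof. by elim: s => [|A s IHs] /=; rewrite ?(val_bot val_v) // val_or IHs. Qed.

End Connectives.

(** * The relation ≼ under a fixed valuation *)

Section Comparison.
Variables (L : logic) (v : form -> bool).
Hypothesis val_v : valuation L v.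

Lemma val_axiom_imp A B : hilbert L (A ⟶ B) -> v A -> v B.
Proof. by move=> /(val_thm val_v); rewrite (val_imp val_v) => /implyP. Qed.

Lemma val_cp_trans A B C : v (A ≼ B) -> v (B ≼ C) -> v (A ≼ C).
Proof.
by move=> vAB vBC; apply: val_axiom_imp (H_tr _ A B C) _; rewrite (val_and val_v) vAB.
Qed.

(** The hypothesis ranges over all valuations, not just [v], because (cpr) applies only to theorems;
    completeness turns it into one. *)
Lemma val_cpr A B :
  (forall u, valuation L u -> u A -> u B) -> v (B ≼ A).
Proof.
move=> AB; apply: (val_thm val_v); apply/H_cpr/hilbert_complete => u val_u.
by rewrite (val_imp val_u); apply/implyP/AB.
Qed.

Lemma val_cp_refl A : v (A ≼ A).
Proof. exact: val_cpr. Qed.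

Lemma val_cp_bot A B : v (⊥ ≼ B) -> v (A ≼ B).
Proof.
by apply: val_cp_trans; apply: val_cpr => u val_u; rewrite (val_bot val_u).
Qed.

Lemma val_cp_big_or A s : all (fun X => v (A ≼ X)) s -> v (A ≼ foldr Or ⊥ s).
Proof.
(* The empty disjunction is ⊥, and [A] ≼ ⊥ follows from ⊥ ≼ ⊥. *)
elim: s => [_ | B s IHs /= /andP[vAB /IHs vAs]]; first exact/val_cp_bot/val_cp_refl.
by apply: val_axiom_imp (H_or _ A B _) _; rewrite (val_and val_v) vAB.
Qed.

(** (or) gives [A] ≼ ⋁s, (cpr) gives ⋁s ≼ [B], and (tr) composes them. *)
Lemma val_cp_entail A B s :
    all (fun X => v (A ≼ X)) s ->
    (forall u, valuation L u -> u B -> has u s) ->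
  v (A ≼ B).
Proof.
move=> /val_cp_big_or vAs Bs; apply: val_cp_trans vAs _; apply: val_cpr => u val_u uB.
by rewrite (val_big_or val_u); apply: Bs.
Qed.

End Comparison.

(** * Sequents *)

Section AllHasMset.
Variables (K : choiceType) (a : pred K).
Implicit Types (x : K) (s : seq K) (M N : {mset K}).

Lemma all_seq_mset s : all a (seq_mset s) = all a s.
Proof. exact/perm_all/perm_eq_seq_mset. Qed.

Lemma has_seq_mset s : has a (seq_mset s) = has a s.
Proof. exact/perm_has/perm_eq_seq_mset. Qed.

Lemma all_msetD M N : all a (M `+` N) = all a M && all a N.
Proof.
by rewrite -all_cat; apply: eq_all_r => x; rewrite mem_cat; apply: in_msetD.
Qed.

Lemma has_msetD M N : has a (M `+` N) = has a M || has a N.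
Proof.
by rewrite -has_cat; apply: eq_has_r => x; rewrite mem_cat; apply: in_msetD.
Qed.

Lemma all_mset1 x : all a [mset x] = a x.
Proof. by rewrite enum_msetn /= andbT. Qed.

Lemma has_mset1 x : has a [mset x] = a x.
Proof. by rewrite enum_msetn /= orbF. Qed.

End AllHasMset.

Definition sat (v : form -> bool) (s : sequent) : bool := all v s.1 ==> has v s.2.

Definition valid (L : logic) (s : sequent) : Prop :=
  forall v, valuation L v -> sat v s.

Lemma valid_hilbert L Γ Δ : valid L (Γ ⇒ Δ) -> hilbert L (bigAnd Γ ⟶ bigOr Δ).
Proof.
move=> valid_s; apply: hilbert_complete => v val_v.
rewrite (val_imp val_v) (val_big_and val_v) (val_big_or val_v).
exact: valid_s val_v.
Qed.

(** Separates the premises indexed by k from the final premise, for the rules with a family Σ. *)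
Lemma valid_rcons_map L (T : finType) (f : T -> sequent) q :
    (forall p, p \in rcons [seq f k | k <- enum T] q -> valid L p) ->
  (forall k, valid L (f k)) /\ valid L q.
Proof.
move=> valid_ps; split=> [k|]; apply: valid_ps; rewrite mem_rcons inE ?eqxx //.
by rewrite map_f ?orbT ?mem_enum.
Qed.

(** * Successive use of the premises of a ≼-rule *)

Section Chain.
Variables (L : logic) (v : form -> bool).
Hypothesis val_v : valuation L v.

(* [s] collects the side formulas of the rule. *)
Lemma val_cp_chain n (S : n.-tuple (form * form)) A s :
    all (fun X => v (A ≼ X)) s -> all v (Sigma S) ->
    (forall (k : 'I_n) u, valuation L u -> u (Cs S k) -> has u s || has u (Ds S k)) ->
  all (fun X => v (A ≼ X)) (Ds S n).
Proof.
rewrite !all_seq_mset all_map => vs /allP vS prem.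
(* The induction carries [s] along with the first k formulas D, since each premise may use both. *)
suff chain k : k <= n -> all (fun X => v (A ≼ X)) (s ++ take k [seq CD.2 | CD <- S]).
  by have := chain n (leqnn n); rewrite all_cat => /andP[].
elim: k => [|k IHk] lt_kn; first by rewrite take0 cats0.
(* The formula at index k is D_(k+1); the defaults ⊥ and (⊥, ⊥) are never reached, as k < n. *)
rewrite (take_nth ⊥) ?size_map ?size_tuple // -rcons_cat all_rcons IHk ?(ltnW lt_kn) //.
rewrite andbT; set k' := Ordinal lt_kn.
rewrite (nth_map (⊥, ⊥)) ?size_tuple // -(tnth_nth _ _ k').
(* Σ supplies C_(k+1) ≼ D_(k+1), so it remains to get [A] ≼ C_(k+1) from the premise. *)
apply: (val_cp_trans val_v) (vS _ (mem_tnth k' S)).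
apply: (val_cp_entail val_v (IHk (ltnW lt_kn))) => u val_u /(prem k' u val_u).
by rewrite has_seq_mset has_cat.
Qed.

Lemma val_cp_rule n (S : n.-tuple (form * form)) A B s :
    all (fun X => v (A ≼ X)) s -> all v (Sigma S) ->
    (forall (k : 'I_n) u, valuation L u -> u (Cs S k) -> has u s || has u (Ds S k)) ->
    (forall u, valuation L u -> u B -> has u s || has u (Ds S n)) ->
  v (A ≼ B).
Proof.
move=> vs vS premC premB.
apply: (val_cp_entail val_v (s := s ++ Ds S n)) => [|u val_u /(premB u val_u)].
- by rewrite all_cat vs (val_cp_chain vs vS premC).
- by rewrite has_cat.
Qed.

End Chain.

(** * Rules *)

Lemma propositional_valid L ps s :
  propositional ps s -> (forall p, p \in ps -> valid L p) -> valid L s.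
Proof.
case=> [|[|[|]]] [].
- move=> p Γ Δ _ v val_v; rewrite /sat /= all_msetD has_msetD all_mset1 has_mset1.
  by case: (v (Atom p)); rewrite //= implybT.
- move=> Γ Δ _ v val_v; rewrite /sat /= all_msetD all_mset1.
  by rewrite (val_bot val_v).
- move=> A B Γ Δ valid_ps v val_v.
  have := valid_ps _ (mem_last _ _) v val_v.
  have := valid_ps _ (mem_head _ _) v val_v.
  rewrite /sat /= !all_msetD !has_msetD !all_mset1 !has_mset1 (val_imp val_v).
  by case: (v A); case: (v B); case: (all v _); case: (has v _).
- move=> A B Γ Δ valid_ps v val_v; have := valid_ps _ (mem_head _ _) v val_v.
  rewrite /sat /= !all_msetD !has_msetD !all_mset1 !has_mset1 (val_imp val_v).
  by case: (v A); case: (v B); case: (all v _); case: (has v _).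
Qed.

Lemma ruleCP_valid L n ps s :
  ruleCP n ps s -> (forall p, p \in ps -> valid L p) -> valid L s.
Proof.
case=> S A B Γ Δ /valid_rcons_map[validC validB] v val_v; apply/implyP => /=.
rewrite all_msetD has_msetD has_mset1 => /andP[_ vS].
apply/orP; left; apply: (val_cp_rule val_v (s := [:: A]) _ vS) => [|k u|u] /=.
- by rewrite (val_cp_refl val_v).
- move=> val_u uC; have := validC k u val_u.
  by rewrite /sat /= all_mset1 has_msetD has_mset1 uC orbF.
- move=> val_u uB; have := validB u val_u.
  by rewrite /sat /= all_mset1 has_msetD has_mset1 uB orbF.
Qed.

(** With ⊥ and ⊤ as the compared formulas, the premises would make ⊥ ≼ ⊤ true, against (n). *)
Lemma ruleN_valid L n ps s :
    hilbert L (¬ (⊥ ≼ ⊤)) ->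
  ruleN n ps s -> (forall p, p \in ps -> valid L p) -> valid L s.
Proof.
move=> thm_n [] S Γ Δ /valid_rcons_map[validC validT] v val_v; apply/implyP => /=.
rewrite all_msetD => /andP[_ vS].
have := val_thm val_v thm_n; rewrite (val_neg val_v) => /negP[].
apply: (val_cp_rule val_v (s := [::]) _ vS) => // [k u|u] /= val_u uC.
- by have := validC k u val_u; rewrite /sat /= all_mset1 uC.
- by have := validT u val_u; rewrite /sat /= enum_mset0.
Qed.

(** The chain gives ⊥ ≼ D_i for every i, so by (t) all D_i are false and the last premise must make
    a formula of Δ true. *)
Lemma ruleT_valid L n ps s :
    (forall A, hilbert L ((⊥ ≼ A) ⟶ ¬ A)) ->
  ruleT n ps s -> (forall p, p \in ps -> valid L p) -> valid L s.
Proof.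
move=> thm_t [] S Γ Δ /valid_rcons_map[validC validG] v val_v.
have := validG v val_v; rewrite /sat /= has_msetD.
case/boolP: (all v _) => //= vG /orP[/hasP[X DX vX]|//].
have vS : all v (Sigma S) by move: vG; rewrite all_msetD => /andP[].
have /allP/(_ X DX) : all (fun X => v (⊥ ≼ X)) (Ds S n).
  apply: (val_cp_chain val_v (s := [::]) _ vS) => // k u val_u uC.
  by have := validC k u val_u; rewrite /sat /= all_mset1 uC.
by move/(val_axiom_imp val_v (thm_t X)); rewrite (val_neg val_v) vX.
Qed.

(** If [X] is [A] or some D_i and is true, then [A] ≼ [X] ≼ ⊤ ≼ [B], the middle step by (w). *)
Lemma ruleW_valid L n ps s :
    (forall A, hilbert L (A ⟶ (A ≼ ⊤))) ->
  ruleW n ps s -> (forall p, p \in ps -> valid L p) -> valid L s.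
Proof.
move=> thm_w [] S A B Γ Δ /valid_rcons_map[validC validG] v val_v.
have cpB X : v (A ≼ X) -> v X -> v (A ≼ B).
  move=> vAX /(val_axiom_imp val_v (thm_w X)) vXT.
  apply: (val_cp_trans val_v) (val_cp_trans val_v vAX vXT) _.
  by apply: (val_cpr val_v) => u val_u _; apply: val_top val_u.
have := validG v val_v; rewrite /sat /= !has_msetD !has_mset1.
case/boolP: (all v _) => //= vG /or4P[vA|->//|/hasP[X DX vX]|->]; last 1 first.
- by rewrite orbT.
- by rewrite (cpB A) // (val_cp_refl val_v).
rewrite (cpB X) //; move: X DX {vX}; apply/allP.
have vS : all v (Sigma S) by move: vG; rewrite all_msetD => /andP[].
apply: (val_cp_chain val_v (s := [:: A]) _ vS) => [|k u val_u uC] /=.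
- by rewrite (val_cp_refl val_v).
- have := validC k u val_u.
  by rewrite /sat /= all_mset1 has_msetD has_mset1 uC orbF.
Qed.

(** When [A] ≼ [B] and [B] are true, (w) and (tr) give [A] ≼ ⊤, and (c) gives [A]. So if the second
    premise yields [B], the first one applies. *)
Lemma ruleC0_valid L ps s :
    (forall A, hilbert L (A ⟶ (A ≼ ⊤))) -> (forall A, hilbert L ((A ≼ ⊤) ⟶ A)) ->
  ruleC0 ps s -> (forall p, p \in ps -> valid L p) -> valid L s.
Proof.
move=> thm_w thm_c [] A B Γ Δ valid_ps v val_v.
have := valid_ps _ (mem_last _ _) v val_v.
have := valid_ps _ (mem_head _ _) v val_v.
rewrite /sat /= !all_msetD !has_msetD !all_mset1 !has_mset1.
have [vAB|//] := boolP (v (A ≼ B)).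
have AB : v B -> v A.
  move/(val_axiom_imp val_v (thm_w B))/(val_cp_trans val_v vAB).
  exact: (val_axiom_imp val_v (thm_c A)).
case: (v A) AB => //; case: (v B) => [/(_ isT)//|_ _].
by case: (all v _).
Qed.

(** * Contexts under the absoluteness axioms *)

Section Absolute.
Variables (L : logic) (v : form -> bool).
Hypothesis val_v : valuation L v.
Hypothesis thm_am : forall A B, hilbert L ((A ≼ B) ⟶ (⊥ ≼ ¬ (A ≼ B))).
Hypothesis thm_a : forall A B, hilbert L (¬ (A ≼ B) ⟶ (⊥ ≼ (A ≼ B))).

(** The disjunction of this list is classically equivalent to ⋀Γ → ⋁Δ; kept as a list, its members
    can be compared with [A] one at a time. *)
Definition context_neg (Γ Δ : {mset form}) : seq form := [seq ¬ X | X <- Γ] ++ Δ.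

Lemma has_context_neg Γ Δ u :
  valuation L u -> has u (context_neg Γ Δ) = (all u Γ ==> has u Δ).
Proof.
move=> val_u; rewrite has_cat has_map implybE -has_predC.
by congr (_ || _); apply: eq_has => X /=; rewrite (val_neg val_u).
Qed.

Lemma val_cp_context_neg A (Γ Δ : {mset form}) :
    all is_cp Γ -> all is_cp Δ -> all v Γ -> ~~ has v Δ ->
  all (fun X => v (A ≼ X)) (context_neg Γ Δ).
Proof.
move=> /allP cpΓ /allP cpΔ /allP vΓ /hasPn vΔ; rewrite all_cat all_map.
apply/andP; split; apply/allP => X in_X /=; apply: (val_cp_bot val_v).
- case: X in_X (cpΓ X in_X) (vΓ X in_X) => // C D _ _.
  exact: (val_axiom_imp val_v (thm_am C D)).
- case: X in_X (cpΔ X in_X) (vΔ X in_X) => // C D _ _.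
  by rewrite -(val_neg val_v); apply: (val_axiom_imp val_v (thm_a C D)).
Qed.

End Absolute.

Lemma all_cp_part Γ : all is_cp (cp_part Γ).
Proof. by rewrite all_seq_mset filter_all. Qed.

Lemma all_cp_Sigma n (S : n.-tuple (form * form)) : all is_cp (Sigma S).
Proof. by rewrite all_seq_mset all_map; apply/allP. Qed.

Lemma cp_part_sub Γ : {subset cp_part Γ <= Γ}.
Proof.
by move=> X; rewrite (perm_mem (perm_eq_seq_mset _)) mem_filter => /andP[].
Qed.

Lemma sub_all_cp_part (v : pred form) (Γ : {mset form}) : all v Γ -> all v (cp_part Γ).
Proof. by move=> /allP vΓ; apply/allP => X /cp_part_sub/vΓ. Qed.

Lemma hasN_cp_part (v : pred form) (Δ : {mset form}) : ~~ has v Δ -> ~~ has v (cp_part Δ).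
Proof. by move=> /hasPn vΔ; apply/hasPn => X /cp_part_sub/vΔ. Qed.

(** Argue by contradiction: once [A] ≼ [B] is assumed false, its copy in the premises counts as one
    more false context formula. *)
Lemma ruleA_valid L n ps s :
    (forall A B, hilbert L ((A ≼ B) ⟶ (⊥ ≼ ¬ (A ≼ B)))) ->
    (forall A B, hilbert L (¬ (A ≼ B) ⟶ (⊥ ≼ (A ≼ B)))) ->
  ruleA n ps s -> (forall p, p \in ps -> valid L p) -> valid L s.
Proof.
move=> thm_am thm_a [] S A B Γ Δ /valid_rcons_map[validC validB] v val_v.
apply/implyP; rewrite /= all_msetD has_msetD has_mset1 => /andP[vΓ vS].
case/boolP: (v (A ≼ B) || _) => //; rewrite negb_or => /andP[nvAB nvΔ].
pose Γ' := cp_part Γ `+` Sigma S; pose Δ' := (A ≼ B) +` cp_part Δ.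
have side : all (fun X => v (A ≼ X)) (A :: context_neg Γ' Δ').
  rewrite /= (val_cp_refl val_v); apply: (val_cp_context_neg val_v) => //.
  - by rewrite all_msetD all_cp_part all_cp_Sigma.
  - by rewrite all_msetD all_mset1 all_cp_part.
  - by rewrite all_msetD vS (sub_all_cp_part vΓ).
  - by rewrite has_msetD has_mset1 negb_or nvAB (hasN_cp_part nvΔ).
case/negP: nvAB; apply: (val_cp_rule val_v side vS) => [k u|u] val_u uX /=.
- have := validC k u val_u; rewrite /= (has_context_neg _ _ val_u) /sat /=.
  rewrite !(all_msetD, has_msetD, all_mset1, has_mset1) uX /=.
  case: (u A) => //; case: (has u (Ds S k)); rewrite ?orbT //=.
  by rewrite orbF.
- have := validB u val_u; rewrite /= (has_context_neg _ _ val_u) /sat /=.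
  rewrite !(all_msetD, has_msetD, all_mset1, has_mset1) uX /=.
  case: (u A) => //; case: (has u (Ds S n)); rewrite ?orbT //=.
  by rewrite orbF.
Qed.

(** The argument for [ruleN] with the context formulas as side formulas, compared with ⊥. *)
Lemma ruleNA_valid L n ps s :
    hilbert L (¬ (⊥ ≼ ⊤)) ->
    (forall A B, hilbert L ((A ≼ B) ⟶ (⊥ ≼ ¬ (A ≼ B)))) ->
    (forall A B, hilbert L (¬ (A ≼ B) ⟶ (⊥ ≼ (A ≼ B)))) ->
  ruleNA n ps s -> (forall p, p \in ps -> valid L p) -> valid L s.
Proof.
move=> thm_n thm_am thm_a [] S Γ Δ /valid_rcons_map[validC validT] v val_v.
apply/implyP; rewrite /= all_msetD => /andP[vΓ vS].
case/boolP: (has v Δ) => // nvΔ.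
pose Γ' := cp_part Γ `+` Sigma S.
have side : all (fun X => v (⊥ ≼ X)) (context_neg Γ' (cp_part Δ)).
  apply: (val_cp_context_neg val_v) => //.
  - by rewrite all_msetD all_cp_part all_cp_Sigma.
  - exact: all_cp_part.
  - by rewrite all_msetD vS (sub_all_cp_part vΓ).
  - exact: hasN_cp_part nvΔ.
have := val_thm val_v thm_n; rewrite (val_neg val_v) => /negP[].
apply: (val_cp_rule val_v side vS) => [k u|u] val_u uX.
- have := validC k u val_u; rewrite (has_context_neg _ _ val_u) /sat /=.
  rewrite !(all_msetD, has_msetD, all_mset1) uX /=.
  by case: (has u (Ds S k)); rewrite ?orbT ?orbF.
- have := validT u val_u; rewrite (has_context_neg _ _ val_u) /sat /=.
  rewrite !(all_msetD, has_msetD) /=.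
  by case: (has u (Ds S n)); rewrite ?orbT ?orbF.
Qed.

Lemma calculus_valid L ps s :
  calculus L ps s -> (forall p, p \in ps -> valid L p) -> valid L s.
Proof.
(* Stated for any logic, since five of the calculi contain the rules of G.N. *)
have GN_valid L' : GN ps s -> (forall p, p \in ps -> valid L' p) -> valid L' s.
  by case=> [|[n]]; [exact: propositional_valid | exact: ruleCP_valid].
case: L => /=; first exact: GN_valid.
- case=> [|[n _]]; [exact: GN_valid | apply: ruleN_valid].
  exact/H_extra/Ax_n.
- case=> [|[n _]]; [exact: GN_valid | apply: ruleT_valid => A].
  exact/H_extra/Ax_t.
- case=> [|[[n]|[n _]]]; first exact: GN_valid.
  + by apply: ruleW_valid => A; apply: H_extra; right.
  + by apply: ruleT_valid => A; apply: H_extra; left.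
- case=> [|[|]]; first exact: GN_valid.
  + by apply: ruleW_valid => A; apply: H_extra; right; left.
  + by apply: ruleC0_valid => A; apply: H_extra; right; [left | right].
- case=> [|[n]]; first exact: propositional_valid.
  by apply: ruleA_valid => A B; apply: H_extra; [left | right].
- case=> [[|[n]]|[n _]]; first exact: propositional_valid.
  + by apply: ruleA_valid => A B; apply: H_extra; right; [left | right].
  + apply: ruleNA_valid => [|A B|A B]; apply: H_extra; first by left.
    * by right; left.
    * by right; right.
Qed.

Theorem theorem4p1 (L : logic) (Γ Δ : {mset form}) :
  derivable (calculus L) (Γ ⇒ Δ) -> hilbert L (bigAnd Γ ⟶ bigOr Δ).
Proof.
move=> der; apply: valid_hilbert.
by elim: der => ps s rule_s _; apply: calculus_valid.
Qed.
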